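(* Let $m\in\mathbb{N}_0$, $\lambda\in\mathbb{N}_0^m$ and $p,q\in V(\lambda)$. Put $C:=\mathcal{H}_+\cup\overline{\mathbb{R}_+}$ and $\widetilde{C}:=\mathcal{H}_-\cup\overline{\mathbb{R}_-}$, where closures are taken in $\mathbb{CP}^1$ (so both $C$ and $\widetilde C$ contain $0$ and $\infty$). If $p$ is $C^m$-stable and $q$ is $\widetilde{C}^m$-stable, then $D^\lambda(p\otimes q)\neq 0$.
   Context: For $\lambda=(\lambda_1,\dots,\lambda_m)\in\mathbb{N}_0^m$, $V(\lambda)$ is the complex vector space of polynomials $p(x_1,y_1,\dots,x_m,y_m)$ with complex coefficients that are homogeneous of degree $\lambda_k$ in the pair $(x_k,y_k)$ for each $k$. Points of $\mathbb{CP}^1$ are written $(a:b)$ and identified with the Riemann sphere $\mathbb{C}\cup\{\infty\}$ via $(a:b)\leftrightarrow a/b$, $(1:0)=\infty$. Zeros of $p\in V(\lambda)$ are considered in $(\mathbb{CP}^1)^m$, the pair $(x_k,y_k)$ corresponding to the $k$-th factor. For $\Omega\subseteq(\mathbb{CP}^1)^m$, $p$ is $\Omega$-stable if it has no zero in $\Omega$. $\mathcal{H}_+,\mathcal{H}_-\subset\mathbb{C}\subset\mathbb{CP}^1$ are the open upper and lower half-planes, and $\mathbb{R}_+,\mathbb{R}_-$ are the sets of positive and negative reals. The apolarity form $D^\lambda: V(\lambda)\otimes V(\lambda)\to V(0^m)\otimes V(0^m)\cong\mathbb{C}$ is $D^\lambda:=\prod_{i=1}^m(\partial_{x_i}\otimes\partial_{y_i}-\partial_{y_i}\otimes\partial_{x_i})^{\lambda_i}$;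 explicitly $D^\lambda(p\otimes q)=\sum_{\mu\le\lambda}\binom{\lambda}{\mu}(-1)^{|\mu|}\,(\partial_x^{\lambda-\mu}\partial_y^{\mu}p)\,(\partial_x^{\mu}\partial_y^{\lambda-\mu}q)$, with multi-index notation $\binom{\lambda}{\mu}=\prod_k\binom{\lambda_k}{\mu_k}$, $\partial_x^\mu=\prod_k\partial_{x_k}^{\mu_k}$. *)

(* Defs.v *)
From mathcomp Require Import all_boot all_order all_algebra.
From mathcomp Require Import boolp classical_sets reals topology normedtype.
From mathcomp Require Import complex.
(* The notations of mpoly clash with those of mathcomp-analysis. *)
From mathcomp Require Import -(notations) mpoly.

Set Implicit Arguments.
Unset Strict Implicit.
Unset Printing Implicit Defensive.

Import Order.TTheory GRing.Theory Num.Theory.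
Import numFieldNormedType.Exports.

Local Open Scope classical_set_scope.
Local Open Scope ring_scope.

(* CP^1 as the Riemann sphere, None being infinity; the topology of the complex
   numbers is carried by the regular-algebra alias R[i]^o. *)
Notation CP1 R := (one_point_compactification R[i]^o).

(* The point (a : b), for (a, b) <> (0, 0). *)
Definition CP1_point (R : realType) (a b : R[i]) : CP1 R :=
  if b == 0 then None else Some (a / b).

Definition CP1_of (R : realType) (A : set R[i]) : set (CP1 R) :=
  [set Some z | z in A].

Definition upper_half_plane (R : realType) : set R[i] :=
  [set z | 0 < complex.Im z].
Arguments upper_half_plane : clear implicits.

Definition lower_half_plane (R : realType) : set R[i] :=
  [set z | complex.Im z < 0].
Arguments lower_half_plane : clear implicits.

Definition pos_reals (R : realType) : set R[i] :=
  [set x%:C%C | x in [set x : R | 0 < x]].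
Arguments pos_reals : clear implicits.

Definition neg_reals (R : realType) : set R[i] :=
  [set x%:C%C | x in [set x : R | x < 0]].
Arguments neg_reals : clear implicits.

Definition regionC (R : realType) : set (CP1 R) :=
  CP1_of (upper_half_plane R) `|` closure (CP1_of (pos_reals R)).
Arguments regionC : clear implicits.

Definition regionC' (R : realType) : set (CP1 R) :=
  CP1_of (lower_half_plane R) `|` closure (CP1_of (neg_reals R)).
Arguments regionC' : clear implicits.

Definition cart_power (T : Type) (m : nat) (A : set T) : set ('I_m -> T) :=
  [set z | forall k, A (z k)].
Arguments cart_power {T} m A.

(* [multinom m], written 'X_{1..m} in mpoly, is the type of multi-indices in N^m.
   Polynomials in x_1, ..., x_m, y_1, ..., y_m: the variables of index
   lshift m k and rshift m k are x_k and y_k. *)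
Notation xypoly R m := (mpoly (m + m)%N R[i]).

Definition xy_join (T : Type) (m : nat) (a b : 'I_m -> T) (i : 'I_(m + m)) : T :=
  match fintype.split i with inl k => a k | inr k => b k end.

Definition V (R : realType) (m : nat) (lam : multinom m) : set (xypoly R m) :=
  [set p : xypoly R m | forall mu : multinom (m + m),
     mu \in msupp p -> forall k : 'I_m,
        (mu (lshift m k) + mu (rshift m k) = lam k)%N].

(* Meaningful for p in some V(lam): vanishing of p at homogeneous coordinates
   of z then does not depend on the coordinates chosen. *)
Definition is_zero (R : realType) (m : nat) (p : xypoly R m)
    (z : 'I_m -> CP1 R) : Prop :=
  exists a b : 'I_m -> R[i],
    [/\ forall k, (a k, b k) != (0, 0),
        forall k, z k = CP1_point (a k) (b k)
      & meval (xy_join a b) p = 0].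

Definition stable (R : realType) (m : nat) (Omega : set ('I_m -> CP1 R))
    (p : xypoly R m) : Prop :=
  forall z, Omega z -> ~ is_zero p z.

(* \partial_x^alpha \partial_y^beta p *)
Definition dxy (R : realType) (m : nat) (alpha beta : multinom m)
    (p : xypoly R m) : xypoly R m :=
  mderivm (Multinom [tuple xy_join alpha beta i | i < m + m]) p.

(* The identification of V(0^m) with the complex numbers. *)
Definition const_val (R : realType) (m : nat) (p : xypoly R m) : R[i] :=
  mcoeff mnm0 p.

(* D^lam (p (x) q) for p, q in V(lam). The sum is over all mu <= lam; the
   degree bound in the index type only makes it finite. *)
Definition apolarity (R : realType) (m : nat) (lam : multinom m)
    (p q : xypoly R m) : R[i] :=
  \sum_(mu : bmultinom m (mdeg lam).+1 | lem mu lam)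
     (\prod_(k < m) 'C(lam k, (mu : multinom m) k))%N%:R
     * (-1) ^+ mdeg mu
     * const_val (dxy (mnm_sub lam mu) mu p)
     * const_val (dxy mu (mnm_sub lam mu) q).

(* Main.v *)
Require Import Defs.
From mathcomp Require Import all_boot all_order all_algebra.
From mathcomp Require Import boolp classical_sets reals topology normedtype.
From mathcomp Require Import complex.
From mathcomp Require Import -(notations) mpoly.
From mathcomp Require Import zify ring lra.

(* The regions C and C~ cover CP^1 and both contain 0. Peel off the operators
   \partial_x (x) \partial_y - \partial_y (x) \partial_x one at a time: each
   of them preserves the absence of zeros on C^m x C~^m. For the k-th pair of
   variables, let G(zeta, omega) be the result of applying the polar derivative
   in direction zeta to the left factor and in direction omega to the right
   factor. By Laguerre's theorem on polar derivatives, applied on both sides,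
   the bilinear form G does not vanish for zeta in C and omega in C~. If the
   operator produced a zero, G would be symmetric; but then the point omega with
   G(0, omega) = G(omega, 0) = 0 lies neither in C~ nor in C. *)

Set Implicit Arguments.
Unset Strict Implicit.
Unset Printing Implicit Defensive.
Import Order.TTheory GRing.Theory Num.Theory.
Import numFieldNormedType.Exports.

Local Open Scope ring_scope.

(** * Half-open half-planes as cones in homogeneous coordinates *)

Section HalfPlanes.
Local Open Scope complex_scope.
Variable R : rcfType.
Implicit Types (a b c d s u v : R[i]).

(** Nonnegativity for the lexicographic order that compares imaginary parts first, then real parts.
    This order is total and, unlike a closed half-plane, antisymmetric. *)
Definition lexge0 u : bool :=
  (0 < complex.Im u) || ((complex.Im u == 0) && (0 <= complex.Re u)).

(* The cone over the half-open half-plane: angles [0, pi) if [e = false],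
   [pi, 2 pi) if [e = true], in both cases with 0 and infinity added. *)
Definition hcone (e : bool) a b : bool :=
  ((a, b) != (0, 0)) && lexge0 ((-1) ^+ e * (a * b^*)).

Lemma lexge0D u v : lexge0 u -> lexge0 v -> lexge0 (u + v).
Proof.
case: u v => [u1 u2] [v1 v2]; rewrite /lexge0 /=.
move=> /orP[hu|/andP[/eqP hu hu']] /orP[hv|/andP[/eqP hv hv']]; apply/orP.
- by left; lra.
- by left; lra.
- by left; lra.
- by right; apply/andP; split; [apply/eqP; lra | lra].
Qed.

Lemma lexge0_sum (I : eqType) (r : seq I) (F : I -> R[i]) :
  (forall i, i \in r -> lexge0 (F i)) -> lexge0 (\sum_(i <- r) F i).
Proof.
move=> hF; rewrite big_seq; elim/big_ind: _ => // [|u v]; last exact: lexge0D.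
by rewrite /lexge0 /= eqxx lexx orbT.
Qed.

Lemma lexge0_total u : lexge0 u || lexge0 (- u).
Proof.
case: u => [u1 u2]; rewrite /lexge0 /= !oppr_gt0 !oppr_ge0 oppr_eq0.
by case: (ltgtP u2 0) => //= _; apply: le_total.
Qed.

Lemma lexge0_anti u : lexge0 u -> lexge0 (- u) -> u = 0.
Proof.
case: u => [u1 u2]; rewrite /lexge0 /= !oppr_gt0 !oppr_ge0 oppr_eq0.
by case: (ltgtP u2 0) => //= -> h1 h2; congr Complex; lra.
Qed.

Lemma lexge0_normM s u : lexge0 u -> lexge0 (s * s^* * u).
Proof.
case: s u => [s1 s2] [u1 u2]; rewrite /lexge0 /=.
have -> : s1 * - s2 + s2 * s1 = 0 by ring.
have -> : s1 * s1 - s2 * - s2 = s1 ^+ 2 + s2 ^+ 2 by ring.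
rewrite !mul0r subr0 addr0.
have : 0 <= s1 ^+ 2 + s2 ^+ 2 by rewrite addr_ge0 ?sqr_ge0.
set n := _ + _; rewrite le_eqVlt => /orP[/eqP <-|n0].
  by rewrite !mul0r eqxx lexx orbT.
by rewrite pmulr_rgt0 // mulf_eq0 pmulr_rge0 // (gt_eqF n0).
Qed.

Lemma hcone_total e a b : (a, b) != (0, 0) -> hcone e a b || hcone (~~ e) a b.
Proof.
move=> ab; rewrite /hcone ab /=.
have := lexge0_total ((-1) ^+ e * (a * b^*)); case: e => /=;
  by rewrite ?expr1 ?expr0 !mulN1r !mul1r ?opprK.
Qed.

Lemma hcone01 e : hcone e 0 1.
Proof.
rewrite /hcone xpair_eqE oner_eq0 andbF mul0r mulr0.
by rewrite /lexge0 /= eqxx lexx orbT.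
Qed.

(** Outside the cone the value is strictly negative for the lexicographic order unless both
    coordinates vanish, so a value 0 leaves only the pair (0, 0). *)
Lemma not_hcone e a b : ~~ hcone e a b -> lexge0 (- ((-1) ^+ e * (a * b^*))) /\
  (lexge0 ((-1) ^+ e * (a * b^*)) -> a = 0 /\ b = 0).
Proof.
rewrite /hcone negb_and negbK => /orP[/eqP[-> ->]|h].
  by rewrite mul0r mulr0 oppr0 /lexge0 /= eqxx lexx orbT.
by move: (lexge0_total ((-1) ^+ e * (a * b^*))); rewrite (negbTE h).
Qed.

(* With [u s] the value of a b^* at the point [s W + zeta], the vanishing of
   the sum of the [s] in [r] makes the cross terms cancel in the sum of the
   [u s], which leaves \sum |s|^2 u_W + (size r) u_zeta, where u_W and u_zeta
   have the sign opposite to that of the [u s]. *)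
Lemma hcone_centroid (e : bool) (r : seq R[i]) a b c d :
  hcone e a b -> hcone e c d -> (0 < size r)%N -> \sum_(s <- r) s = 0 ->
  (forall s, s \in r -> ~~ hcone e (s * a + c) (s * b + d)) -> False.
Proof.
move=> /andP[_ hW] /andP[cd0 hZ] r0 sum0 hr.
pose sg : R[i] := (-1) ^+ e.
pose u s := sg * ((s * a + c) * (s * b + d)^*).
have sumE : \sum_(s <- r) u s =
    \sum_(s <- r) s * s^* * (sg * (a * b^*)) +
    \sum_(s <- r) sg * (c * d^*).
  rewrite -big_split /=.
  have h1 : \sum_(s <- r) s * (sg * a * d^*) = 0.
    by rewrite -mulr_suml sum0 mul0r.
  have h2 : \sum_(s <- r) s^* * (sg * c * b^*) = 0.
    by rewrite -mulr_suml -rmorph_sum sum0 rmorph0 mul0r.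
  rewrite -[RHS]addr0 -[X in _ = _ + X]h1 -[RHS]addr0 -[X in _ = _ + X]h2.
  rewrite -!big_split /=.
  by apply: eq_bigr => s _; rewrite /u rmorphD rmorphM /=; ring.
have uN s : s \in r -> lexge0 (- u s) by move=> /hr/not_hcone[].
have Zge : lexge0 (\sum_(s <- r) sg * (c * d^*)) by apply: lexge0_sum.
have Wge : lexge0 (\sum_(s <- r) s * s^* * (sg * (a * b^*))).
  by apply: lexge0_sum => s _; apply: lexge0_normM.
(* By [sumE] the sum is nonnegative, by [uN] it is nonpositive; a zero sum of nonpositive terms has
   only zero terms. *)
have sum_u0 : \sum_(s <- r) u s = 0.
  apply: lexge0_anti; first by rewrite sumE lexge0D.
  by rewrite -sumrN; apply: lexge0_sum.
have u0 s : s \in r -> u s = 0.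
  move=> sr; apply/eqP; rewrite -oppr_eq0; apply/eqP.
  apply: lexge0_anti; first exact: uN.
  rewrite opprK; move: sum_u0; rewrite (big_rem s) //= => /eqP.
  rewrite addr_eq0 => /eqP ->; rewrite -sumrN.
  by apply: lexge0_sum => t /mem_rem; apply: uN.
have v0 s : s \in r -> s * a + c = 0 /\ s * b + d = 0.
  move=> sr; have [_] := not_hcone (hr s sr); apply.
  by have := u0 s sr; rewrite /u => ->; rewrite /lexge0 /= eqxx lexx orbT.
(* Summing s x + y over [r] leaves (size r) y = 0, and the characteristic is 0. *)
have cent x y : (forall s, s \in r -> s * x + y = 0) -> y = 0.
  move=> h; have : \sum_(s <- r) (s * x + y) = 0 by rewrite big_seq big1.
  rewrite big_split /= -mulr_suml sum0 mul0r add0r.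
  rewrite (big_nth 0) sumr_const_nat subn0 => /eqP.
  by rewrite mulrn_eq0 eqn0Ngt r0 => /eqP.
have c0 : c = 0 by apply: (cent a) => s /v0[].
have d0 : d = 0 by apply: (cent b) => s /v0[].
by move: cd0; rewrite c0 d0 eqxx.
Qed.

End HalfPlanes.

Lemma subm_self n (mu : multinom n) : mnm_sub mu mu = mnm0.
Proof. by apply/mnmP => x; rewrite mnmBE mnm0E subnn. Qed.

(** * Restriction of a polynomial to a line and its two leading coefficients *)

Section LineRestriction.
Variables (F : comNzRingType) (n : nat) (i j : 'I_n) (z : 'I_n -> F) (c d : F).
Implicit Types (f g : mpoly n F) (h : {poly F}).
Hypothesis neq_ij : i != j.

(** The polar derivative in direction (c, d) with respect to the pair of variables [i], [j]. *)
Definition polar f : mpoly n F := c *: mderiv i f + d *: mderiv j f.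

Lemma polar0 : polar 0 = 0.
Proof. by rewrite /polar !mderiv0 !scaler0 addr0. Qed.

Lemma polarD f g : polar (f + g) = polar f + polar g.
Proof. by rewrite /polar !mderivD !scalerDr addrACA. Qed.

Lemma polarZ a f : polar (a *: f) = a *: polar f.
Proof.
by rewrite /polar !mderivZ scalerDr !scalerA [c * a]mulrC [d * a]mulrC.
Qed.

Definition line_pt (s : F) (l : 'I_n) : F :=
  if l == i then s * z i + c else if l == j then s * z j + d else z l.

Definition line_var (l : 'I_n) : {poly F} :=
  if l == i then z i *: 'X + c%:P
  else if l == j then z j *: 'X + d%:P else (z l)%:P.

Definition line_poly f : {poly F} := mmap (@polyC F) line_var f.

Lemma horner_line_poly f s : (line_poly f).[s] = meval (line_pt s) f.
Proof.
rewrite /line_poly /meval /mmap horner_sum; apply: eq_bigr => mu _.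
rewrite hornerM hornerC; congr (_ * _); rewrite /mmap1 horner_prod.
apply: eq_bigr => l _; rewrite horner_exp; congr (_ ^+ _).
rewrite /line_var /line_pt.
by do ![case: ifP => _]; rewrite ?hornerD ?hornerZ ?hornerX ?hornerC // mulrC.
Qed.

(* [h] has leading terms u X^k + v X^(k-1); the factor X is there for k = 0,
   where this forces v = 0. *)
Definition lead2 (k : nat) (u v : F) h : Prop :=
  (size ('X * h - u *: 'X^(k.+1) - v *: 'X^k)%R <= k)%N.

Lemma lead2D k u v u' v' h h' :
  lead2 k u v h -> lead2 k u' v' h' -> lead2 k (u + u') (v + v') (h + h').
Proof.
move=> H H'; rewrite /lead2 mulrDr !scalerDl.
set A := (X in (size (polyseq X) <= _)%N).
have -> : A = ('X * h - u *: 'X^(k.+1) - v *: 'X^k) +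
    ('X * h' - u' *: 'X^(k.+1) - v' *: 'X^k) by rewrite /A; ring.
by rewrite (leq_trans (size_polyD _ _)) // geq_max; apply/andP; split.
Qed.

Lemma lead2Z k a u v h : lead2 k u v h -> lead2 k (a * u) (a * v) (a *: h).
Proof.
move=> H; rewrite /lead2 -!scalerA -scalerAr -!scalerBr.
exact: leq_trans (size_scale_leq _ _) H.
Qed.

Lemma lead2M k u v h k' u' v' h' : lead2 k u v h -> lead2 k' u' v' h' ->
  lead2 (k + k') (u * u') (v * u' + u * v') (h * h').
Proof.
rewrite /lead2; set r := (X in (size (polyseq X) <= k)%N).
set r' := (X in (size (polyseq X) <= k')%N).
move=> H H'; set A := (X in (size (polyseq X) <= _)%N).
(* The top terms of (X h)(X h') cancel. What remains has size at most k + k' + 1, and removing the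
   factor X lowers this bound by one. *)
have XA : 'X * A = (v * v') *: 'X^(k + k') + r * (u' *: 'X^(k'.+1)) +
     r * (v' *: 'X^k') + r' * (u *: 'X^(k.+1)) + r' * (v *: 'X^k) + r * r'.
  by rewrite /A /r /r' -!mul_polyC !rmorphD !rmorphM /= !exprS !exprD; ring.
suff : (size ('X * A)%R <= (k + k').+1)%N.
  have [->|A0] := eqVneq A 0; first by rewrite size_poly0.
  by rewrite mulrC size_mulX.
have sM (p q : {poly F}) a b :
    (size p <= a -> size q <= b -> size (p * q)%R <= (a + b).-1)%N.
  by have := size_polyMleq p q; lia.
have sX a l : (size (a *: 'X^l : {poly F})%R <= l.+1)%N.
  by apply: leq_trans (size_scale_leq _ _) _; rewrite size_polyXn.
have sD (p q : {poly F}) a :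
    (size p <= a -> size q <= a -> size (p + q)%R <= a)%N.
  by have := size_polyD p q; lia.
rewrite XA.
apply: (sD); last by apply: leq_trans (sM _ _ _ _ H H') _; lia.
apply: (sD); last by apply: leq_trans (sM _ _ _ _ H' (sX _ _)) _; lia.
apply: (sD); last by apply: leq_trans (sM _ _ _ _ H' (sX _ _)) _; lia.
apply: (sD); last by apply: leq_trans (sM _ _ _ _ H (sX _ _)) _; lia.
apply: (sD); last by apply: leq_trans (sM _ _ _ _ H (sX _ _)) _; lia.
exact: sX.
Qed.

Let Q (f : mpoly n F) (k : nat) : Prop :=
  lead2 k (meval z f) (meval z (polar f)) (line_poly f).

(** The Leibniz rule for [polar] has the shape of the second coefficient in [lead2M]. *)
Let QM f g k l : Q f k -> Q g l -> Q (f * g) (k + l).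
Proof.
move=> Hf Hg; rewrite /Q mevalM.
have -> : line_poly (f * g) = line_poly f * line_poly g by apply: rmorphM.
have -> : meval z (polar (f * g)) =
    meval z (polar f) * meval z g + meval z f * meval z (polar g).
  by rewrite /polar !mderivM !(mevalD, mevalZ, mevalM); ring.
exact: lead2M Hf Hg.
Qed.

Let Q1 : Q 1 0.
Proof.
rewrite /Q meval1 (_ : line_poly 1 = 1); last exact: rmorph1.
rewrite /polar -mpolyC1 !mderivC !scaler0 addr0.
by rewrite meval0 /lead2 scale0r scale1r mulr1 expr1 !subrr size_poly0.
Qed.

Let QX l : Q (mpolyX F (mnm1 l)) ((l == i) + (l == j)).
Proof.
rewrite /Q /line_poly mmapX mmap1U mevalXU /polar !mderivX !mnm1E.
have [->|li] := eqVneq l i.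
  rewrite (negbTE neq_ij) scale0r scaler0 addr0 scale1r mevalZ.
  rewrite subm_self mpolyX0 meval1 mulr1 /lead2 /line_var eqxx addn0.
  rewrite (_ : _ - _ = 0) ?size_poly0 //.
  by rewrite -!mul_polyC expr1 expr2; ring.
have [->|lj] := eqVneq l j.
  rewrite scale0r scaler0 add0r scale1r mevalZ.
  rewrite subm_self mpolyX0 meval1 mulr1 /lead2 /line_var eqxx.
  rewrite eq_sym (negbTE neq_ij).
  rewrite (_ : _ - _ = 0) ?size_poly0 //.
  by rewrite -!mul_polyC expr1 expr2; ring.
rewrite !scale0r !scaler0 addr0 meval0 /lead2 /line_var (negbTE li) (negbTE lj).
by rewrite scale0r subr0 expr1 mulrC mul_polyC subrr size_poly0.
Qed.

(** Taylor expansion s^k f(z) + s^(k-1) (polar f)(z) + ... for f homogeneous of degree k in the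
    pair. It holds for single variables, passes to monomials by products, and to f by linearity at
    fixed k. *)
Lemma lead2_line_poly f k :
  (forall mu : multinom n, mu \in msupp f -> (mu i + mu j)%N = k) ->
  lead2 k (meval z f) (meval z (polar f)) (line_poly f).
Proof.
move=> hf; rewrite -[lead2 _ _ _ _]/(Q f k) [f]mpolyE big_seq.
have QD g g' : Q g k -> Q g' k -> Q (g + g') k.
  move=> Hg Hh; rewrite /Q mevalD /line_poly mmapD.
  have -> : meval z (polar (g + g')) = meval z (polar g) + meval z (polar g').
    by rewrite polarD mevalD.
  exact: lead2D.
have QZ a g : Q g k -> Q (a *: g) k.
  move=> Hg; rewrite /Q mevalZ /line_poly mmapZ mul_polyC.
  have -> : meval z (polar (a *: g)) = a * meval z (polar g).
    by rewrite polarZ mevalZ.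
  exact: lead2Z.
have QXm mu : mu \in msupp f -> Q (mpolyX F mu) k.
  move=> /hf <-; rewrite mpolyXE_id.
  have -> : (mu i + mu j)%N = (\sum_(l < n) ((l == i) + (l == j)) * mu l)%N.
    rewrite (eq_bigr (fun l : 'I_n => (if l == i then mu l else 0) +
       (if l == j then mu l else 0))%N); last first.
      by move=> l _; rewrite mulnDl; do 2!case: eqP => _; rewrite ?mul1n ?mul0n.
    by rewrite big_split /= -!big_mkcond /= !big_pred1_eq.
  elim/big_ind2: _ => // [f1 k1 f2 k2|l _]; first exact: QM.
  elim: (mu l) => [|e IH]; first by rewrite expr0 muln0.
  by rewrite exprS mulnS; apply: QM.
elim/big_ind: _ => // [|mu /QXm]; last exact: QZ.
rewrite /Q polar0 meval0 /line_poly mmap0.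
by rewrite /lead2 mulr0 !scale0r !subr0 size_poly0.
Qed.

End LineRestriction.

Lemma lead2P (F : comNzRingType) k (u v : F) h : (0 < k)%N -> lead2 k u v h ->
  [/\ (size h <= k.+1)%N, h`_k = u & h`_k.-1 = v].
Proof.
move=> k0 /leq_sizeP hk.
have {}hk l : (k <= l.+1)%N -> h`_l = u *+ (l == k) + v *+ (l.+1 == k).
  move=> /hk; rewrite !coefB coefXM !coefZ !coefXn eqSS /= !mulr_natr => /eqP.
  by rewrite -addrA -opprD subr_eq0 => /eqP.
split.
- apply/leq_sizeP => l kl; rewrite hk ?(leq_trans (ltnW kl)) // -?(ltnS k).
  by rewrite !gtn_eqF ?addr0 ?(ltnW kl) // ltnW.
- by rewrite hk // eqxx gtn_eqF ?addr0.
- by rewrite hk prednK // eqxx ltn_eqF ?add0r // ltn_predL.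
Qed.

(** * Laguerre's theorem on polar derivatives *)

Section Laguerre.
Variables (R : rcfType) (n : nat) (e : bool) (i j : 'I_n).
Implicit Types (f : mpoly n R[i]) (z : 'I_n -> R[i]).

(* The polynomial h(s) = f(s z + (c, d)), with only the variables i and j
   moving, has leading coefficients f(z) and (polar f)(z); if the latter is 0,
   its roots sum to zero and [hcone_centroid] applies. *)
Lemma laguerre f k z c d : i != j -> (0 < k)%N ->
  (forall mu : multinom n, mu \in msupp f -> (mu i + mu j)%N = k) ->
  hcone e (z i) (z j) -> hcone e c d ->
  (forall z', (forall l, l != i -> l != j -> z' l = z l) ->
     hcone e (z' i) (z' j) -> meval z' f != 0) ->
  meval z (polar i j c d f) != 0.
Proof.
move=> ij k0 hf hz hcd stf; apply/negP => /eqP polar0.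
set h := line_poly i j z c d f.
have [sh hk] := lead2P k0 (lead2_line_poly z c d ij hf).
rewrite -/h polar0 => hk1.
(* [z] itself lies in the cone, so the leading coefficient f(z) is nonzero and h has exactly k roots
   with multiplicity. *)
have fz0 : meval z f != 0 by apply: stf.
have size_h : size h = k.+1.
  apply/eqP; rewrite eqn_leq sh ltnNge /=.
  apply/negP => /leq_sizeP/(_ k (leqnn _)).
  by rewrite hk => /eqP; apply/negP.
have h0 : lead_coef h != 0 by rewrite lead_coefE size_h /= hk.
have [r hE] := closed_field_poly_normal h.
have size_r : size r = k.
  by move: size_h; rewrite hE size_scale // size_prod_XsubC => -[].
have sum0 : \sum_(s <- r) s = 0.
  (* Vieta: the coefficient of X^(k-1) is minus the leading coefficient times the sum of the
     roots. *)
  have := @coefPn_prod_XsubC _ r; rewrite -lt0n size_r => /(_ k0)/eqP.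
  rewrite -(inj_eq (mulfI h0)) -coefZ -hE.
  by rewrite hk1 mulrN eq_sym oppr_eq0 mulf_eq0 (negbTE h0) => /eqP.
apply: (hcone_centroid hz hcd _ sum0); first by rewrite size_r.
move=> s sr; apply/negP => hs.
have : h.[s] = 0 by apply/rootP; rewrite hE rootZ // root_prod_XsubC.
rewrite horner_line_poly; apply/eqP/stf => [l /negbTE li /negbTE lj|].
  by rewrite /line_pt li lj.
by rewrite /line_pt !eqxx eq_sym (negbTE ij).
Qed.

End Laguerre.

(** * Multi-indices below a given one and Pascal's rule *)

Section Box.
Variable m : nat.
Implicit Types (mu nu : multinom m) (k : 'I_m).

(** A list over the plain type of multi-indices, so that sums with different bounds share one index
    type. *)
Definition box mu : seq (multinom m) :=
  [seq bmnm x | x <- enum {: bmultinom m (mdeg mu).+1} & lem (bmnm x) mu].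

Definition mbin mu nu : nat := (\prod_(k < m) 'C(mu k, nu k))%N.

Lemma box_uniq mu : uniq (box mu).
Proof.
rewrite map_inj_uniq; first exact: filter_uniq (enum_uniq _).
by move=> x y; apply: val_inj.
Qed.

Lemma mdeg_lem mu nu : lem nu mu -> (mdeg nu <= mdeg mu)%N.
Proof. by move=> /forallP h; rewrite !mdegE; apply: leq_sum. Qed.

Lemma mem_box mu nu : (nu \in box mu) = lem nu mu.
Proof.
apply/mapP/idP => [[x + ->]|h]; first by rewrite mem_filter => /andP[].
have b : (mdeg nu < (mdeg mu).+1)%N by rewrite ltnS mdeg_lem.
by exists (BMultinom b); rewrite // mem_filter h mem_enum.
Qed.

Lemma big_box (F : nmodType) mu (G : multinom m -> F) :
  \sum_(x : bmultinom m (mdeg mu).+1 | lem (bmnm x) mu) G (bmnm x) =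
  \sum_(nu <- box mu) G nu.
Proof. by rewrite big_map big_filter big_enum_cond. Qed.

(** Pascal's rule in the k-th factor. The test [0 < nu k] removes the second term when [nu k] is 0,
    where the truncated [mnm_sub] would return [nu]. *)
Lemma mbin_pascal mu nu k :
  mbin (mnm_add mu (mnm1 k)) nu =
  (mbin mu nu + (0 < nu k) * mbin mu (mnm_sub nu (mnm1 k)))%N.
Proof.
have split_k mu' nu' : mbin mu' nu' =
  ('C(mu' k, nu' k) * \prod_(l < m | l != k) 'C(mu' l, nu' l))%N.
  by rewrite /mbin (bigD1 k).
rewrite !split_k mnmDE mnmBE !mnm1E eqxx addn1.
have -> : (\prod_(l < m | l != k) 'C(mu l, mnm_sub nu (mnm1 k) l) =
           \prod_(l < m | l != k) 'C(mu l, nu l))%N.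
  by apply: eq_bigr => l lk; rewrite mnmBE mnm1E eq_sym (negbTE lk) subn0.
have -> : (\prod_(l < m | l != k) 'C(mnm_add mu (mnm1 k) l, nu l) =
           \prod_(l < m | l != k) 'C(mu l, nu l))%N.
  by apply: eq_bigr => l lk; rewrite mnmDE mnm1E eq_sym (negbTE lk) addn0.
by case: (nu k) => [|s]; rewrite ?bin0 ?addn0 // subn1 mul1n binS mulnDl.
Qed.

Lemma mbin_eq0 mu nu : ~~ lem nu mu -> mbin mu nu = 0%N.
Proof.
rewrite negb_forall => /existsP[k]; rewrite -ltnNge => h.
by rewrite /mbin (bigD1 k) //= bin_small.
Qed.

(** In the first sum the extra indices carry a zero binomial; in the second, adding [mnm1 k] maps
    [box mu] bijectively onto the indices with positive k-th entry. *)
Lemma box_pascal (F : pzRingType) mu k (G : multinom m -> F) :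
  \sum_(nu <- box (mnm_add mu (mnm1 k)))
    (mbin (mnm_add mu (mnm1 k)) nu)%:R * G nu =
  \sum_(nu <- box mu) (mbin mu nu)%:R * G nu +
  \sum_(nu <- box mu) (mbin mu nu)%:R * G (mnm_add nu (mnm1 k)).
Proof.
under eq_bigr do rewrite mbin_pascal natrD mulrDl.
rewrite big_split /=; congr (_ + _).
  rewrite (bigID (fun nu => lem nu mu)) /= [X in _ + X]big1 ?addr0; last first.
    by move=> nu /mbin_eq0 ->; rewrite mul0r.
  rewrite -big_filter; apply: perm_big; apply: uniq_perm.
  - by rewrite filter_uniq ?box_uniq.
  - exact: box_uniq.
  move=> nu; rewrite mem_filter !mem_box andb_idr // => /forallP h.
  by apply/forallP => l; rewrite mnmDE (leq_trans (h l)) ?leq_addr.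
rewrite (bigID (fun nu : multinom m => 0 < nu k)%N) /=.
rewrite [X in _ + X]big1 ?addr0; last first.
  by move=> nu; rewrite -leqNgt leqn0 => /eqP ->; rewrite mul0n mul0r.
rewrite -big_filter; pose s := [seq mnm_add nu (mnm1 k) | nu <- box mu].
rewrite (perm_big s) /=; last first.
  apply: uniq_perm; first by rewrite filter_uniq ?box_uniq.
    by rewrite map_inj_uniq ?box_uniq //; apply: addIm.
  move=> nu; rewrite mem_filter mem_box; apply/andP/mapP => [[k0 /forallP h]|].
    exists (mnm_sub nu (mnm1 k)); last first.
      rewrite submK //; apply/mnm_lepP => l; rewrite mnm1E.
      by case: eqP => // <-.
    rewrite mem_box; apply/forallP => l; have := h l.
    by rewrite mnmDE mnmBE leq_subLR addnC.
  move=> [nu' + ->]; rewrite mem_box => /forallP h; split.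
    by rewrite mnmDE mnm1E eqxx addn1.
  by apply/forallP => l; rewrite !mnmDE leq_add2r.
rewrite big_map; apply: eq_bigr => nu _.
by rewrite mnmDE mnm1E eqxx addn1 mul1n addmK.
Qed.

End Box.

(** * The operators D^mu as bilinear pairings *)

Section Pairing.
Variables (R : realType) (m : nat).
Implicit Types (lam mu nu : multinom m) (p q : xypoly R m) (k : 'I_m).
Implicit Types (z w : 'I_(m + m) -> R[i]).

(** The value of D^mu(p (x) q) at [z] in the left factor and [w] in the right one. *)
Definition pairing mu p q z w : R[i] :=
  \sum_(nu <- box mu) (mbin mu nu)%:R *
    ((-1) ^+ mdeg nu * meval z (dxy (mnm_sub mu nu) nu p)
                     * meval w (dxy nu (mnm_sub mu nu) q)).

Lemma xy_mnmE mu nu i :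
  Multinom [tuple xy_join mu nu i | i < m + m] i = xy_join mu nu i.
Proof. exact: mnmE. Qed.

Lemma mderiv_dxy i mu nu p : mderiv i (dxy mu nu p) = dxy mu nu (mderiv i p).
Proof. by rewrite /dxy -mderivmU1m -!mderivmDm addmC mderivmDm mderivmU1m. Qed.

Lemma dxy_addx mu nu k p :
  dxy (mnm_add mu (mnm1 k)) nu p = dxy mu nu (mderiv (lshift m k) p).
Proof.
rewrite -mderiv_dxy /dxy -mderivmU1m -mderivmDm; congr mderivm.
apply/mnmP => i; rewrite mnmDE !xy_mnmE mnm1E /xy_join.
case: splitP => j ij.
  by rewrite mnmDE mnm1E -!val_eqE /= ij.
by rewrite -val_eqE /= ij ltn_eqF ?addn0 // ltn_addr.
Qed.

Lemma dxy_addy mu nu k p :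
  dxy mu (mnm_add nu (mnm1 k)) p = dxy mu nu (mderiv (rshift m k) p).
Proof.
rewrite -mderiv_dxy /dxy -mderivmU1m -mderivmDm; congr mderivm.
apply/mnmP => i; rewrite mnmDE !xy_mnmE mnm1E /xy_join.
case: splitP => j ij.
  by rewrite -val_eqE /= ij gtn_eqF ?addn0 // ltn_addr.
by rewrite mnmDE mnm1E -!val_eqE /= ij eqn_add2l.
Qed.

(** One factor of the operator is peeled off; the minus sign is the extra -1 that the shift of [nu]
    by [mnm1 k] brings. *)
Lemma pairing_add mu k p q z w :
  pairing (mnm_add mu (mnm1 k)) p q z w =
  pairing mu (mderiv (lshift m k) p) (mderiv (rshift m k) q) z w -
  pairing mu (mderiv (rshift m k) p) (mderiv (lshift m k) q) z w.
Proof.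
rewrite /pairing box_pascal -sumrN; congr (_ + _); rewrite !big_seq.
  apply: eq_bigr => nu; rewrite mem_box => h.
  have -> : mnm_sub (mnm_add mu (mnm1 k)) nu = mnm_add (mnm_sub mu nu) (mnm1 k).
    by rewrite addmC -addmBA // addmC.
  by rewrite dxy_addx dxy_addy.
apply: eq_bigr => nu; rewrite mem_box => h.
have -> : mnm_sub (mnm_add mu (mnm1 k)) (mnm_add nu (mnm1 k)) = mnm_sub mu nu.
  by apply/mnmP => l; rewrite !mnmE subnDr.
by rewrite dxy_addx dxy_addy mdegD mdeg1 addn1 exprS; ring.
Qed.

(** Freezing the right factor at [w] makes the pairing a polynomial in [z] alone, to which
    [laguerre] applies; [right_poly] exchanges the roles. *)
Definition left_poly mu q w p : xypoly R m :=
  \sum_(nu <- box mu) ((mbin mu nu)%:R * (-1) ^+ mdeg nu *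
    meval w (dxy nu (mnm_sub mu nu) q)) *: dxy (mnm_sub mu nu) nu p.

Definition right_poly mu p z q : xypoly R m :=
  \sum_(nu <- box mu) ((mbin mu nu)%:R * (-1) ^+ mdeg nu *
    meval z (dxy (mnm_sub mu nu) nu p)) *: dxy nu (mnm_sub mu nu) q.

Lemma meval_left_poly mu p q z w :
  meval z (left_poly mu q w p) = pairing mu p q z w.
Proof.
rewrite /left_poly raddf_sum /=; apply: eq_bigr => nu _.
by rewrite mevalZ; ring.
Qed.

Lemma meval_right_poly mu p q z w :
  meval w (right_poly mu p z q) = pairing mu p q z w.
Proof.
rewrite /right_poly raddf_sum /=; apply: eq_bigr => nu _.
by rewrite mevalZ; ring.
Qed.

Lemma polar_dxy i j c d mu nu p :
  polar i j c d (dxy mu nu p) = dxy mu nu (polar i j c d p).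
Proof. by rewrite /polar !mderiv_dxy /dxy mderivmD !mderivmZ. Qed.

Lemma polar_left i j c d mu p q w :
  polar i j c d (left_poly mu q w p) = left_poly mu q w (polar i j c d p).
Proof.
rewrite /left_poly (big_morph _ (polarD _ _ _ _) (polar0 _ _ _ _)).
by apply: eq_bigr => nu _; rewrite polarZ polar_dxy.
Qed.

Lemma polar_right i j c d mu p q z :
  polar i j c d (right_poly mu p z q) = right_poly mu p z (polar i j c d q).
Proof.
rewrite /right_poly (big_morph _ (polarD _ _ _ _) (polar0 _ _ _ _)).
by apply: eq_bigr => nu _; rewrite polarZ polar_dxy.
Qed.

End Pairing.

(** * Nonvanishing of the pairings by induction on the order *)

Section Apolarity.
Variables (R : realType) (m : nat).
Implicit Types (lam mu nu : multinom m) (p q : xypoly R m) (k : 'I_m).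
Implicit Types (z w : 'I_(m + m) -> R[i]).

Definition in_cones (e : bool) z : Prop :=
  forall k, hcone e (z (lshift m k)) (z (rshift m k)).

Lemma pairing_linear_l mu p p' q z w a b :
  pairing mu (a *: p + b *: p') q z w =
  a * pairing mu p q z w + b * pairing mu p' q z w.
Proof.
rewrite /pairing !mulr_sumr -big_split /=; apply: eq_bigr => nu _.
by rewrite /dxy mderivmD !mderivmZ mevalD !mevalZ; ring.
Qed.

Lemma pairing_linear_r mu p q q' z w a b :
  pairing mu p (a *: q + b *: q') z w =
  a * pairing mu p q z w + b * pairing mu p q' z w.
Proof.
rewrite /pairing !mulr_sumr -big_split /=; apply: eq_bigr => nu _.
by rewrite /dxy mderivmD !mderivmZ mevalD !mevalZ; ring.
Qed.

Lemma pairing0 p q z w : pairing mnm0 p q z w = meval z p * meval w q.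
Proof.
rewrite /pairing (perm_big [:: mnm0 : multinom m]) /=; last first.
  apply: uniq_perm (box_uniq _) _ _ => // nu; rewrite mem_box inE.
  apply/forallP/eqP => [h|-> //]; apply/mnmP => l.
  by have := h l; rewrite mnm0E leqn0 => /eqP.
have dxy0 p' : dxy mnm0 mnm0 p' = p'.
  rewrite /dxy -[RHS]mderivm0m; congr mderivm; apply/mnmP => i.
  by rewrite xy_mnmE /xy_join; case: splitP => j _; rewrite !mnm0E.
rewrite big_seq1 subm_self !dxy0 /mbin big1 => [|l _].
  by rewrite mdeg0 !mul1r.
by rewrite mnm0E bin0.
Qed.

Lemma mcoeff_dxy lam p mu nu al k : V lam p ->
  mcoeff al (dxy mu nu p) != 0 ->
  (mu k + nu k + (al (lshift m k) + al (rshift m k)))%N = lam k.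
Proof.
move=> hp; rewrite mcoeff_mderivm => h.
set M := Multinom _ in h.
have /hp/(_ k) <- : mnm_add M al \in msupp p.
  by rewrite mcoeff_msupp; apply: contraNneq h => ->; rewrite mul0rn.
rewrite !mnmDE !xy_mnmE /xy_join !(unsplitK (inl k)) !(unsplitK (inr k)).
lia.
Qed.

(** Every term differentiates [p] exactly [mu k] times in the k-th pair, whatever [nu] is, so the
    sum stays homogeneous. *)
Lemma msupp_left_poly lam p q mu w k al : V lam p ->
  al \in msupp (left_poly mu q w p) ->
  (al (lshift m k) + al (rshift m k))%N = (lam k - mu k)%N.
Proof.
move=> hp; rewrite mcoeff_msupp raddf_sum /=; apply: contraNeq => ne.
rewrite big_seq big1 // => nu; rewrite mem_box mcoeffZ => /forallP/(_ k) h.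
have [->|/(mcoeff_dxy k hp)] := eqVneq (mcoeff al (dxy (mnm_sub mu nu) nu p)) 0.
  by rewrite mulr0.
by rewrite mnmBE subnK // => e; case/eqP: ne; rewrite -e addKn.
Qed.

Lemma msupp_right_poly lam p q mu z k al : V lam q ->
  al \in msupp (right_poly mu p z q) ->
  (al (lshift m k) + al (rshift m k))%N = (lam k - mu k)%N.
Proof.
move=> hq; rewrite mcoeff_msupp raddf_sum /=; apply: contraNeq => ne.
rewrite big_seq big1 // => nu; rewrite mem_box mcoeffZ => /forallP/(_ k) h.
have [->|/(mcoeff_dxy k hq)] := eqVneq (mcoeff al (dxy nu (mnm_sub mu nu) q)) 0.
  by rewrite mulr0.
by rewrite mnmBE subnKC // => e; case/eqP: ne; rewrite -e addKn.
Qed.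

Lemma in_cones_update e k z z' : in_cones e z ->
  (forall l, l != lshift m k -> l != rshift m k -> z' l = z l) ->
  hcone e (z' (lshift m k)) (z' (rshift m k)) -> in_cones e z'.
Proof.
move=> hz zz' hk l; have [->//|lk] := eqVneq l k.
rewrite !zz' ?(inj_eq (@lshift_inj _ _)) ?(inj_eq (@rshift_inj _ _)) //.
  by rewrite eq_rlshift.
by rewrite eq_lrshift.
Qed.

Lemma pairing_neq0 lam p q mu z w : V lam p -> V lam q -> lem mu lam ->
  (forall z, in_cones false z -> meval z p != 0) ->
  (forall w, in_cones true w -> meval w q != 0) ->
  in_cones false z -> in_cones true w -> pairing mu p q z w != 0.
Proof.
move=> hp hq + stp stq; move: {2}(mdeg mu) (erefl (mdeg mu)) => n.
elim: n mu z w => [|n IH] mu z w.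
  move=> /eqP; rewrite mdeg_eq0 => /eqP -> _ hz hw.
  by rewrite pairing0 mulf_neq0 ?stp ?stq.
move=> degmu lemu hz hw.
have [k muk] : exists k, (0 < mu k)%N.
  apply/existsP; apply: contraTT (ltn0Sn n) => /existsPn h.
  rewrite -degmu mdegE big1 // => l _; apply/eqP.
  by rewrite -leqn0 leqNgt; apply: h.
pose mu' := mnm_sub mu (mnm1 k).
have muE : mu = mnm_add mu' (mnm1 k).
  by rewrite submK //; apply/mnm_lepP => l; rewrite mnm1E; case: eqP => // <-.
have degmu' : mdeg mu' = n.
  by move: degmu; rewrite muE mdegD mdeg1 addn1 => -[].
have lemu' : lem mu' lam.
  apply/forallP => l; apply: leq_trans (forallP lemu l).
  by rewrite mnmBE leq_subr.
have degk : (0 < lam k - mu' k)%N.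
  by have := forallP lemu k; rewrite muE mnmDE mnm1E eqxx subn_gt0 addn1.
have neqxy : lshift m k != rshift m k by rewrite eq_lrshift.
pose pol (c d : R[i]) := polar (lshift m k) (rshift m k) c d.
have H1 (c d : R[i]) z1 w1 : in_cones false z1 -> in_cones true w1 ->
    hcone false c d -> pairing mu' (pol c d p) q z1 w1 != 0.
  move=> hz1 hw1 hcd; rewrite -meval_left_poly -polar_left.
  apply: (laguerre neqxy degk _ (hz1 k) hcd).
    by move=> al; apply: msupp_left_poly.
  move=> z' zz' hz'; rewrite meval_left_poly; apply: IH => //.
  exact: in_cones_update zz' hz'.
(* Now [H1], which holds for all [w1] in the cones, provides the stability in the right factor. *)
have H2 (c d c' d' : R[i]) : hcone false c d -> hcone true c' d' ->
    pairing mu' (pol c d p) (pol c' d' q) z w != 0.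
  move=> hcd hcd'; rewrite -meval_right_poly -polar_right.
  apply: (laguerre neqxy degk _ (hw k) hcd').
    by move=> al; apply: msupp_right_poly.
  move=> w' ww' hw'; rewrite meval_right_poly; apply: H1 => //.
  exact: in_cones_update ww' hw'.
pose G i j := pairing mu' (mderiv i p) (mderiv j q) z w.
rewrite {1}muE pairing_add subr_eq0; apply/negP => /eqP.
rewrite -/(G _ _) -/(G _ _); set Gxy := G _ _; set Gyx := G _ _ => Gsym.
set Gyy := G (rshift m k) (rshift m k); set Gxx := G (lshift m k) (lshift m k).
have GE c d c' d' : pairing mu' (pol c d p) (pol c' d' q) z w =
    c * (c' * Gxx + d' * Gxy) + d * (c' * Gyx + d' * Gyy).
  by rewrite /pol /polar pairing_linear_l !pairing_linear_r.
(* By [Gsym], the pair (Gyy, -Gyx) annihilates (0, 1) from either side. If it is (0, 0), the form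
   vanishes at (0, 1), (0, 1), contradicting [H2]; otherwise it lies in one of the two cones, again
   contradicting [H2]. *)
have [G0|Gn0] := eqVneq (Gyy, - Gyx) (0, 0).
  have := H2 _ _ _ _ (hcone01 R false) (hcone01 R true).
  by rewrite GE; case: G0 => -> _; rewrite !(mul0r, mulr0, add0r, addr0) eqxx.
have /orP[h|h] := hcone_total true Gn0.
  have := H2 _ _ _ _ (hcone01 R false) h; rewrite GE => /negP; apply.
  by apply/eqP; ring.
have := H2 _ _ _ _ h (hcone01 R true); rewrite GE Gsym => /negP; apply.
by apply/eqP; ring.
Qed.

(** By homogeneity the derivatives of full order [lam] are constants, so they have the same value at
    any points [z] and [w]. *)
Lemma apolarityE lam p q z w : V lam p -> V lam q ->
  apolarity lam p q = pairing lam p q z w.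
Proof.
have const (al be : multinom m) (p' : xypoly R m) z' : V lam p' ->
    (forall k, (al k + be k)%N = lam k) ->
    meval z' (dxy al be p') = const_val (dxy al be p').
  move=> hp' albe.
  rewrite (_ : dxy al be p' = mpolyC _ (const_val (dxy al be p'))).
    by rewrite mevalC /const_val mcoeffC eqxx mulr1.
  apply/mpolyP => ga; rewrite mcoeffC /const_val.
  have [<-|ga0] := eqVneq mnm0 ga; first by rewrite mulr1.
  rewrite mulr0; apply: contraNeq ga0 => /mcoeff_dxy h.
  apply/eqP/mnmP => i; rewrite mnm0E.
  case: (split_ordP i) => k ->; have := h lam k hp'; rewrite albe; lia.
move=> hp hq; rewrite /apolarity /pairing -big_box.
apply: eq_bigr => nu /forallP h.
rewrite -/(mbin lam nu) !mulrA !const //.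
- by move=> k; rewrite mnmBE subnKC.
- by move=> k; rewrite mnmBE subnK.
Qed.

End Apolarity.

(** * From the cones to the regions of the Riemann sphere *)

Section Regions.
Local Open Scope complex_scope.
Variable R : realType.
Implicit Types (a b : R[i]).

Lemma closure0 (A : set R[i]) : (forall e : R[i], 0 < e ->
    exists2 x : R[i], A x & `|x| < e) ->
  closure (CP1_of A) (Some 0 : CP1 R).
Proof.
move=> hA B [e /= e0 hB]; have [x Ax xe] := hA e e0.
exists (Some x); split; first by exists x.
by apply: hB; rewrite /ball_ /= sub0r normrN.
Qed.

(** Any N above |x| + 1 bounds the unit ball around x, and compactness makes the choice of N
    uniform. *)
Lemma compact_bound (K : set R[i]^o) : compact K ->
  exists N : R, forall x, K x -> `|x| <= N%:C.
Proof.
move=> /compact_near_coveringP cK.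
have := cK _ (pinfty_nbhs R) (fun (N : R) (x : R[i]) => `|x| <= N%:C) _.
case=> [x Kx|M [_ hM]]; last first.
  by exists (M + 1) => x Kx; apply: (hM (M + 1)); rewrite ?ltrDl.
exists (ball x 1, [set N : R | complex.Re `|x| + 1 < N]%classic) => /=.
  split; first exact: nbhsx_ballx.
  by exists (complex.Re `|x| + 1); split; rewrite ?num_real.
move=> [y N] /= [xy xN].
apply: le_trans (_ : (complex.Re `|x : R[i]| + 1)%:C <= _); last first.
  by rewrite lecR ltW.
have -> : (complex.Re `|x : R[i]| + 1)%:C = `|x : R[i]| + 1.
  rewrite -[in RHS](RRe_real (normr_real (x : R[i]))).
  by rewrite -(rmorphD (real_complex R)).
rewrite -[y](subrKC x) (le_trans (ler_normD _ _)) // lerD2l.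
by rewrite distrC ltW // -ball_normE.
Qed.

(** A neighbourhood of infinity contains the complement of a compact set, which is bounded, so an
    unbounded set meets it. *)
Lemma closure_infty (A : set R[i]) :
  (forall e : R, exists2 x : R[i], A x & e%:C < `|x|) ->
  closure (CP1_of A) (None : CP1 R).
Proof.
move=> hA B [K [cK clK]] hB.
suff [x Ax Kx] : exists2 x, A x & ~ K x.
  by exists (Some x); split; [exists x | apply: hB; left; exists x].
apply: contrapT => h.
have AK x : A x -> K x by move=> Ax; apply: contrapT => nKx; apply: h; exists x.
have [N hN] := compact_bound cK.
have [x /AK/hN xN] := hA N.
by move=> /lt_le_trans/(_ xN); rewrite ltxx.
Qed.

(** The quotient a / b is a b^* times the nonnegative real |1/b|^2. *)
Lemma hcone_div (e : bool) a b : b != 0 ->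
  hcone e a b -> lexge0 ((-1) ^+ e * (a / b)).
Proof.
move=> b0 /andP[_ h].
have := lexge0_normM (b^-1) h; congr (is_true (lexge0 _)).
rewrite mulrCA; congr (_ * _); rewrite rmorphV /= ?unitfE //.
by field; rewrite b0 conjc_eq0 b0.
Qed.

Lemma normr_realC (x : R) : `|x%:C| = `|x|%:C.
Proof. by rewrite normc_def /= expr0n addr0 sqrtr_sqr. Qed.

Lemma exists_real_small (e : R[i]) : 0 < e -> exists2 x : R, 0 < x & x%:C < e.
Proof.
case: e => [r s]; rewrite ltcE /= => /andP[/eqP -> r0].
by exists (r / 2); rewrite ?ltcR; lra.
Qed.

(** Infinity and 0 are limits of positive reals; the other points of the cone lie in the open
    half-plane or are positive reals. *)
Lemma regionC_point a b : hcone false a b -> regionC R (CP1_point a b).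
Proof.
rewrite /CP1_point; case: ifPn => [_ _|b0 /(hcone_div b0)].
  right; apply: closure_infty => e; exists (`|e| + 1)%:C.
    by exists (`|e| + 1); rewrite //= ltr_wpDl.
  rewrite normr_realC ltcR ger0_norm ?addr_ge0 //.
  by rewrite (le_lt_trans (ler_norm e)) // ltrDl.
case: (a / b) => [x y]; rewrite expr0 mul1r => /orP[/= y0|/= /andP[/eqP -> x0]].
  by left; exists (x +i* y).
right; move: x0; rewrite le_eqVlt => /orP[/eqP <-|x0].
  apply: closure0 => e /exists_real_small[t t0 te].
  by exists t%:C; [exists t | rewrite normr_realC gtr0_norm].
by apply: subset_closure; exists x%:C => //; exists x.
Qed.

Lemma regionC'_point a b : hcone true a b -> regionC' R (CP1_point a b).
Proof.
rewrite /CP1_point; case: ifPn => [_ _|b0 /(hcone_div b0)].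
  right; apply: closure_infty => e; exists (- (`|e| + 1))%:C.
    by exists (- (`|e| + 1)); rewrite //= oppr_lt0 ltr_wpDl.
  rewrite normr_realC normrN ltcR ger0_norm ?addr_ge0 //.
  by rewrite (le_lt_trans (ler_norm e)) // ltrDl.
case: (a / b) => [x y]; rewrite expr1 mulN1r => /orP[/= y0|/= /andP[y0 x0]].
  by left; exists (x +i* y); rewrite // /lower_half_plane /= -oppr_gt0.
move: y0 x0; rewrite oppr_eq0 oppr_ge0 => /eqP ->.
right; move: x0; rewrite le_eqVlt => /orP[/eqP ->|x0].
  apply: closure0 => e /exists_real_small[t t0 te].
  exists (- t)%:C; first by exists (- t) => //=; rewrite oppr_lt0.
  by rewrite normr_realC normrN gtr0_norm.
by apply: subset_closure; exists x%:C => //; exists x.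
Qed.

End Regions.

(** * Stability in homogeneous coordinates, and the conclusion *)

Section Stability.
Variables (R : realType) (m : nat).

Lemma stable_in_cones (e : bool) (A : set (CP1 R)) (p : xypoly R m) :
  (forall a b, hcone e a b -> A (CP1_point a b)) ->
  stable (cart_power m A) p -> forall z, in_cones e z -> meval z p != 0.
Proof.
move=> hA stp z hz; apply/eqP => pz0.
pose a k := z (lshift m k); pose b k := z (rshift m k).
apply: (stp (fun k => CP1_point (a k) (b k))) => [k|]; first exact: hA (hz k).
exists a, b; split=> // [k|]; first by have /andP[] := hz k.
rewrite -pz0; apply: meval_eq => i; rewrite /xy_join.
by case: (split_ordP i) => k ->.
Qed.

End Stability.

Theorem theorem5p1 (R : realType) (m : nat) (lam : multinom m)
    (p q : xypoly R m) (hp : V lam p) (hq : V lam q)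
    (stp : stable (cart_power m (regionC R)) p)
    (stq : stable (cart_power m (regionC' R)) q) :
  apolarity lam p q <> 0.
Proof.
(* The point 0 = (0 : 1) in every factor lies in both families of cones. *)
pose zw i : R[i] := xy_join (fun _ : 'I_m => 0) (fun _ => 1) i.
have hzw e : in_cones e zw.
  move=> k; rewrite /zw /xy_join (unsplitK (inl k)) (unsplitK (inr k)).
  exact: hcone01.
rewrite (apolarityE zw zw hp hq); apply/eqP/(pairing_neq0 hp hq) => //.
- exact/forallP.
- exact: stable_in_cones (@regionC_point R) stp.
- exact: stable_in_cones (@regionC'_point R) stq.
Qed.
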